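(* Suppose that $U$ and $W$ are two kernels such that $U$ is an $f$-fractional multiple of $W$ for some $f>0$. Then $\kappa(U)=\frac1f\cdot\kappa(W)$.
   Context: $(\Omega,\mu)$ is a separable atomless probability space. A kernel is a symmetric nonnegative function $W\in L^\infty(\Omega^2)$. For a finite (simple) graph $F$ and a kernel $W$, the homomorphism density of $F$ in $W$ is $$t(F,W)=\int\prod_{uv\in E(F)}W(x_u,x_v)\,d\mu^{\otimes V(F)}\big((x_u)_{u\in V(F)}\big).$$ For $p>0$, a kernel $U$ is a $p$-fractional multiple of a kernel $W$ if for each finite tree $T$ we have $t(T,U)=p^{e(T)}t(T,W)$, where $e(T)$ is the number of edges of $T$. For a kernel $W$, the multitype branching process $\mathfrak X_W$ starts with a single particle whose type has distribution $\mu$; in any generation, each particle of type $x\in\Omega$ has, independently of everything else, offspring whose types form a Poisson process on $\Omega$ with intensity $W(x,y)\,d\mu(y)$. $|\mathfrak X_W|\in\mathbb N\cup\{\infty\}$ is the total number of particles (including the initial one). Define $$\Upsilon(W)=\sum_{k=1}^\infty\frac{\mathbf P[|\mathfrak X_W|=k]}{k},\qquad \kappa(W)=\int_{c=0}^{+\infty}\Upsilon(c\cdot W)\,dc\in[0,+\infty].$$ *)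

(* Defs.v *)
From HB Require Import structures.
From mathcomp Require Import all_boot all_order all_algebra.
From mathcomp Require Import all_classical all_reals all_analysis.
From mathcomp Require Import measurable_realfun.

Set Implicit Arguments.
Unset Strict Implicit.
Unset Printing Implicit Defensive.

Import Order.TTheory GRing.Theory Num.Theory.
Import numFieldNormedType.Exports.

Local Open Scope classical_set_scope.
Local Open Scope ring_scope.
Local Open Scope ereal_scope.

Section product_probability.
Context d1 d2 (T1 : measurableType d1) (T2 : measurableType d2) (R : realType).
Variables (P : probability T1 R) (Q : probability T2 R).

Let PQ := P \x Q.

HB.instance Definition _ := Measure.on PQ.

Let PQ_setT : PQ setT = 1.
Proof.
rewrite /PQ -setXTT product_measure1E//.
rewrite -[RHS]mule1; congr (_ * _); exact: probability_setT.
Qed.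

HB.instance Definition _ := Measure_isProbability.Build _ _ _ PQ PQ_setT.

Definition product_probability : probability (T1 * T2)%type R := PQ.

End product_probability.

Section tuple_power.
Context d (T : measurableType d) (R : realType).

Definition cons_pair n (p : T * n.-tuple T) : n.+1.-tuple T := [tuple of p.1 :: p.2].

Lemma measurable_cons_pair n : measurable_fun [set: T * n.-tuple T] (@cons_pair n).
Proof. exact: measurable_cons. Qed.

HB.instance Definition _ n :=
  isMeasurableFun.Build _ _ _ _ (@cons_pair n) (@measurable_cons_pair n).

(* The n-fold product probability of mu, carried by n.-tuple T. *)
Fixpoint tuple_power (mu : probability T R) n : probability (n.-tuple T) R :=
  match n with
  | 0%N => \d_([tuple] : 0.-tuple T)
  | m.+1 => distribution (product_probability mu (tuple_power mu m)) (@cons_pair m)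
  end.

Variable mu : probability T R.

Lemma measurable_prod_tnth (f : T -> R) n : measurable_fun setT f ->
  measurable_fun [set: n.-tuple T]
    (EFin \o (fun y : n.-tuple T => (\prod_(i < n) f (tnth y i))%R)).
Proof.
move=> mf; apply/measurable_EFinP; apply: measurable_prod => i _.
by apply: measurableT_comp => //; exact: measurable_tnth.
Qed.

Lemma integral_tuple_power_prod (f : T -> R) n :
  measurable_fun setT f -> (forall y, 0 <= f y)%R ->
  \int[tuple_power mu n]_y (\prod_(i < n) f (tnth y i))%:E =
  (\int[mu]_y (f y)%:E) ^+ n.
Proof.
move=> mf f0; elim: n => [|n IH].
  rewrite expe0 /= (eq_integral (cst 1)) => [|y _]; last by rewrite big_ord0.
  by rewrite integral_cst// mul1e; exact: probability_setT.
have f0' m (y : m.-tuple T) : 0 <= (\prod_(i < m) f (tnth y i))%:E.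
  by rewrite lee_fin prodr_ge0.
have mprod m := @measurable_prod_tnth f m mf.
transitivity (\int[product_probability mu (tuple_power mu n)]_p
    (\prod_(i < n.+1) f (tnth (cons_pair p) i))%:E).
  exact: ge0_integral_distribution (mprod n.+1) (f0' n.+1).
rewrite [LHS](@fubini_tonelli1 _ _ _ _ _ mu (tuple_power mu n)) //; last first.
  exact: measurableT_comp (mprod n.+1) (@measurable_cons_pair n).
under eq_integral => x _.
  rewrite /fubini_F/=.
  under eq_integral => y _.
    rewrite big_ord_recl/= EFinM.
    have -> : tnth [tuple of x :: y] ord0 = x by rewrite (tnth_nth x).
    under eq_bigr => i _ do rewrite tnthS.
    over.
  rewrite ge0_integralZl_EFin//; [|by move=> y _; exact: f0'|exact: mprod].
  rewrite IH; over.
rewrite ge0_integralZr//; first by rewrite expeS.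
- exact/measurable_EFinP.
- by move=> x _; rewrite lee_fin.
- by apply: expe_ge0; apply: integral_ge0 => x _; rewrite lee_fin.
Qed.

End tuple_power.

Section base_space.
Context d (T : measurableType d) (R : realType) (mu : probability T R).

Definition atomless := forall A : set T, measurable A -> 0 < mu A ->
  exists B : set T, [/\ measurable B, B `<=` A, 0 < mu B & mu B < mu A].

(* Separability of the measure algebra of mu for the distance mu (A `+` B). *)
Definition separable := exists B : nat -> set T, (forall n, measurable (B n)) /\
  forall A : set T, measurable A -> forall eps : R, (0 < eps)%R ->
    exists n, mu (A `+` B n) < eps%:E.

(* Classes in L^oo are handled through representatives that are symmetric and
   nonnegative everywhere; every symmetric nonnegative class has one. *)
Definition is_kernel (W : T * T -> R) :=
  [/\ W \in Lfun (mu \x mu) +oo,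
      (forall x y, W (x, y) = W (y, x)) &
      (forall x y, 0 <= W (x, y))%R].

End base_space.

Section graphs.
Context (V : finType) (e : rel V).

Definition simple_graph := symmetric e /\ irreflexive e.

Definition acyclic := forall c : seq V, (2 < size c)%N -> ~ ucycle e c.

Definition is_tree :=
  [/\ simple_graph, (0 < #|V|)%N, (forall u v, connect e u v) & acyclic].

(* Every edge uv is listed once, oriented along the enumeration of V. *)
Definition edges : {set V * V} :=
  [set p | e p.1 p.2 & (enum_rank p.1 < enum_rank p.2)%N]%SET.

End graphs.

Section hom_density.
Context d (T : measurableType d) (R : realType) (mu : probability T R).

(* The vertex u carries the coordinate x_u := tnth x (enum_rank u). *)
Definition hom_density (V : finType) (e : rel V) (W : T * T -> R) : \bar R :=
  \int[tuple_power mu #|V|]_x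
    (\prod_(p in edges e)
       W (tnth x (enum_rank p.1), tnth x (enum_rank p.2)))%:E.

Definition fractional_multiple (p : R) (U W : T * T -> R) :=
  forall (V : finType) (e : rel V), is_tree e ->
    hom_density e U = (p ^+ #|edges e|)%:E * hom_density e W.

End hom_density.

Section branching_process.
Context d (T : measurableType d) (R : realType) (mu : probability T R).
Implicit Types (W : T * T -> R) (x : T) (s : seq T).

Definition total_intensity W x : \bar R := \int[mu]_y (W (x, y))%:E.

(* Expectation of h over the points y_1, ..., y_n of a Poisson process with
   intensity W(x, y) dmu(y). The number of points is Poisson of parameter
   total_intensity W x and, given that number, they are independent with law
   proportional to W(x, y) dmu(y), i.e. the process has law
     e^{- lambda(T)} \sum_n lambda^{(x) n} / n!,   lambda(dy) = W(x, y) dmu(y).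
   Only finite configurations contribute: if total_intensity W x = +oo (which
   happens for mu-almost no x when W is a kernel), there are almost surely
   infinitely many points, and the value is 0. *)
Definition poisson_expectation W x (h : seq T -> \bar R) : \bar R :=
  expeR (- total_intensity W x) *
  \sum_(0 <= n <oo) (n`!%:R^-1)%:E *
    \int[tuple_power mu n]_y ((\prod_(i < n) W (x, tnth y i))%:E * h y).

(* With lambda(dy) = W(x, y) dmu(y), the generating functional is
   exp(\int (g - 1) dlambda), as it must be for a Poisson process of intensity
   lambda; this formula determines the law of a finite point process. *)
Lemma poisson_expectation_prod (W : T * T -> R) x (g : T -> R) :
  measurable_fun setT (fun y => W (x, y)) -> (forall y, 0 <= W (x, y))%R ->
  total_intensity W x < +oo ->
  measurable_fun setT g -> (forall y, 0 <= g y <= 1)%R ->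
  poisson_expectation W x (fun y => (\prod_(z <- y) g z)%:E) =
  expeR (\int[mu]_y (W (x, y) * (g y - 1))%:E).
Proof.
move=> mW W0 fW mg g01.
have g0 y : (0 <= g y)%R by have /andP[] := g01 y.
have mWg : measurable_fun setT (fun y => W (x, y) * g y)%R by exact: measurable_funM.
have W_ge0 : 0 <= total_intensity W x.
  by apply: integral_ge0 => y _; rewrite lee_fin.
have fWf : total_intensity W x \is a fin_num by rewrite ge0_fin_numE.
have Wg_ge0 y : 0 <= (W (x, y) * g y)%:E by rewrite lee_fin mulr_ge0.
have Wgf : \int[mu]_y (W (x, y) * g y)%:E \is a fin_num.
  rewrite ge0_fin_numE; last by apply: integral_ge0 => y _; exact: Wg_ge0.
  apply: le_lt_trans fW; apply: ge0_le_integral => //.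
  - exact/measurable_EFinP.
  - exact/measurable_EFinP.
  - by move=> y _; rewrite lee_fin ler_piMr//; have /andP[] := g01 y.
have -> : \int[mu]_y (W (x, y) * (g y - 1))%:E =
    \int[mu]_y (W (x, y) * g y)%:E - total_intensity W x.
  rewrite -integralB_EFin//; first by apply: eq_integral => y _; rewrite -EFinB mulrBr mulr1.
  - apply/integrableP; split; first exact/measurable_EFinP.
    rewrite (eq_integral (fun y => (W (x, y) * g y)%:E)) => [|y _]; last by rewrite gee0_abs ?Wg_ge0.
    by rewrite -ge0_fin_numE//; apply: integral_ge0 => y _; exact: Wg_ge0.
  - apply/integrableP; split; first exact/measurable_EFinP.
    by rewrite (eq_integral (fun y => (W (x, y))%:E)) => [|y _]; last by rewrite gee0_abs ?lee_fin ?W0.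
rewrite /poisson_expectation.
have E n : \int[tuple_power mu n]_y ((\prod_(i < n) W (x, tnth y i))%:E *
    (\prod_(z <- y) g z)%:E) = ((fine (\int[mu]_y (W (x, y) * g y)%:E)) ^+ n)%:E.
  rewrite EFin_expe fineK// -(@integral_tuple_power_prod _ _ _ mu (fun y => W (x, y) * g y)%R)//.
  by apply: eq_integral => y _; rewrite -EFinM big_tuple -big_split.
under eq_eseriesr => n _ do rewrite E -EFinM mulrC.
rewrite -(fineK Wgf) -(fineK fWf) -EFinB/= addrC expRD EFinM; congr (_ * _).
move: (fine (\int[mu]_y (W (x, y) * g y)%:E)) => a.
rewrite /expR -EFin_lim; last exact: is_cvg_series_exp_coeff.
apply/congr_lim/funext => n/=; rewrite /series/= -sumEFin//.
Qed.

(* Expectation of h over the next generation when the current one is s: the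
   particles of s have independent Poisson offspring. *)
Fixpoint offspring_expectation W s (h : seq T -> \bar R) : \bar R :=
  match s with
  | [::] => h [::]
  | x :: s' => poisson_expectation W x (fun y =>
                 offspring_expectation W s' (fun z => h (y ++ z)))
  end.

(* Expectation of h [:: Z_0; ...; Z_n] for the successive generations of the
   process started from Z_0 = s. *)
Fixpoint generations_expectation W n s (h : seq (seq T) -> \bar R) : \bar R :=
  match n with
  | 0%N => h [:: s]
  | m.+1 => offspring_expectation W s (fun s' =>
              generations_expectation W m s' (fun Z => h (s :: Z)))
  end.

(* For Z = [:: Z_0; ...; Z_n]: generation n is empty and there were k particles
   in total. *)
Definition extinct_with_progeny (k : nat) (Z : seq (seq T)) : bool :=
  nilp (last [::] Z) && (sumn (map size Z) == k).

(* P[|X_W| = k]: the event |X_W| = k is the increasing union over n of the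
   events "generation n is empty and generations 0, ..., n have k particles". *)
Definition progeny_prob W (k : nat) : \bar R :=
  limn (fun n => \int[mu]_x generations_expectation W n [:: x]
                   (fun Z => (extinct_with_progeny k Z)%:R%:E)).

Definition Upsilon W : \bar R :=
  \sum_(1 <= k <oo) (k%:R^-1)%:E * progeny_prob W k.

Definition kappa W : \bar R :=
  \int[lebesgue_measure]_(c in `[0%R, +oo[) Upsilon (fun z => (c * W z)%R).

End branching_process.

(* Main.v *)
Require Import Defs.
From mathcomp Require Import all_boot all_order all_algebra.
From mathcomp Require Import all_classical all_reals all_analysis.
From mathcomp Require Import measurable_realfun ess_sup_inf zify.

Import Order.TTheory GRing.Theory Num.Theory.
Import numFieldNormedType.Exports.

Set Implicit Arguments.
Unset Strict Implicit.
Unset Printing Implicit Defensive.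

Local Open Scope classical_set_scope.
Local Open Scope ring_scope.
Local Open Scope ereal_scope.

(** The number of particles only sees a kernel through its tree densities.
Write K_W u (x) for the integral of W(x,y) u(y) dmu(y) and let a_n(x,k) be the
probability that the process started from one particle of type x has died out
by generation n with k particles in total.  Children behave independently, so
conditioning on the number m of children of the root gives
  a_(n+1)(x,k+1) = exp(- K_W 1 (x)) * \sum_(m <= k) 1/m! *
      \sum_(k_1 + ... + k_m = k) \prod_i K_W (a_n(.,k_i)) (x)
([generations_expectation_convs], [poisson_expectation_convs]).  Hence a_n(.,k)
is obtained from constants by sums, products, K_W, and exp(- K_W 1).

Let tau_t(x) be the density of a rooted tree t when the type of its root is x.
These functions are closed under products (glue the roots) and under K_W (hang
the tree on a new root), and their integrals are the tree densities.  Let A and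
B be kernels with equal tree densities.  Two functions u, w have the same
moments if the integral of u tau_t^A is finite and equals that of w tau_t^B for
all t, and (u,w) is a multiplier if (u v, w v') has the same moments whenever
(v,v') does.  Multipliers are closed under sums and products, under bounded
series, under subtraction from a common upper bound, and under K because K is
self-adjoint: the integral of (K u) v tau_t is the integral of u K(v tau_t), and
K(v tau_t) inherits the same moments from v ([multiplier_Kop]).  This duality
replaces any approximation of a_n by combinations of the tau_t.  As (1,1) has
the same moments, multipliers have equal integrals, so the progenies of A and B
have the same law ([same_progeny_prob]).

A rooted tree is realised as a graph by numbering its vertices so that parents
come after children; integrating out the first vertex, always a leaf, turns its
homomorphism density into the integral of tau_t ([hom_density_code]).

With A = c U and B = f c W this gives Upsilon (c U) = Upsilon (f c W) for all
c >= 0, and the substitution c -> f c in the integral defining kappa concludes. *)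

(** * Convolution of sequences indexed by particles *)

Lemma sum_triangle (V : nmodType) (F : nat -> nat -> V) k :
  (\sum_(i < k.+1) \sum_(j < (k - i).+1) F i j =
   \sum_(m < k.+1) \sum_(i < m.+1) F i (m - i)%N)%R.
Proof.
elim: k => [|k IH]; first by rewrite !big_ord1.
rewrite [LHS]big_ord_recr /= subnn big_ord1.
under eq_bigr => i _ do rewrite subSn ?(ltnW (ltn_ord i)) -1?ltnS ?ltn_ord// big_ord_recr/=.
rewrite big_split /= IH [in RHS]big_ord_recr /= -addrA; congr (_ + _)%R.
rewrite [RHS]big_ord_recr /= subnn; congr (_ + _)%R.
by apply: eq_bigr => i _; rewrite subSn// -ltnS.
Qed.

Lemma nneseriesZl_ereal (R : realType) (f : nat -> \bar R) (x : \bar R) :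
  0 <= x -> (forall i, 0 <= f i) ->
  \sum_(0 <= i <oo) (x * f i) = x * \sum_(0 <= i <oo) f i.
Proof.
case: x => [r _ f0|_ f0|//]; first exact: nneseriesZl.
have [f00|] := pselect (forall i, f i = 0).
  by rewrite !eseries0 ?mule0// => i _ _; rewrite f00 ?mule0.
move=> /existsNP[i /eqP fi].
have fi0 : 0 < f i by rewrite lt0e fi f0.
rewrite gt0_mulye; last first.
  by apply: (lt_le_trans fi0); rewrite (nneseriesD1 (n := i))// leeDl//; apply: nneseries_ge0.
apply/eqP; rewrite -leye_eq -[X in X <= _](gt0_mulye fi0).
rewrite (nneseriesD1 (n := i))//; last by move=> k _; rewrite mule_ge0.
by rewrite leeDl//; apply: nneseries_ge0 => k _ _; rewrite mule_ge0.
Qed.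

Section convolution.
Context {R : realType} {X : Type}.
Implicit Types (a b : X -> nat -> \bar R) (s t : seq X) (k : nat).

(** The probability that independent variables attached to the entries x of s, of
    laws [a x], add up to k. *)
Fixpoint convs a s k : \bar R :=
  match s with
  | [::] => (k == 0)%N%:R%:E
  | x :: s' => \sum_(i < k.+1) a x i * convs a s' (k - i)
  end.

Lemma convs_ge0 a s k : (forall x i, 0 <= a x i) -> 0 <= convs a s k.
Proof.
move=> a0; elim: s k => [|x s IH] k /=; first by rewrite lee_fin.
by apply: sume_ge0 => i _; rewrite mule_ge0.
Qed.

Lemma convs1 a x k : convs a [:: x] k = a x k.
Proof.
rewrite /= big_ord_recr /= subnn mule1 big1 ?add0e// => i _.
by rewrite subn_eq0 leqNgt ltn_ord mule0.
Qed.

Lemma convs_cat a s t k : (forall x i, 0 <= a x i) ->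
  convs a (s ++ t) k = \sum_(i < k.+1) convs a s i * convs a t (k - i).
Proof.
move=> a0; have c0 s' k' : 0 <= convs a s' k' by exact: convs_ge0.
elim: s k => [|x s IH] k /=.
  rewrite big_ord_recl /= mul1e subn0 big1 ?adde0// => i _.
  by rewrite mul0e.
transitivity (\sum_(i < k.+1) \sum_(j < (k - i).+1)
    a x i * convs a s j * convs a t (k - (i + j))).
  apply: eq_bigr => i _; rewrite IH ge0_sume_distrr.
    by apply: eq_bigr => j _; rewrite muleA subnDA.
  by move=> j _; rewrite mule_ge0.
rewrite (sum_triangle (fun i j => a x i * convs a s j * convs a t (k - (i + j)))).
apply: eq_bigr => m _; rewrite ge0_sume_distrl; last by move=> i _; rewrite mule_ge0.
by apply: eq_bigr => i _; rewrite subnKC// -ltnS.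
Qed.

(** Passing from the number of strict descendants of a particle to the number of
    particles it is responsible for, itself included. *)
Definition shift b x k : \bar R := if k is k'.+1 then b x k' else 0.

Lemma convs_shift b s k : convs (shift b) s k =
  if (size s <= k)%N then convs b s (k - size s) else 0.
Proof.
elim: s k => [|x s IH] k /=; first by rewrite subn0.
rewrite big_ord_recl /= mul0e add0e.
case: k => [|k]; first by rewrite big_ord0.
under eq_bigr => i _ do rewrite /= /bump/= subSS IH.
rewrite ltnS subSS; case: (leqP (size s) k) => sk; last first.
  by apply: big1 => i _; case: ifPn => [|_]; [lia|rewrite mule0].
rewrite (big_ord_widen k.+1 (fun i => b x i * convs b s (k - size s - i))); last by lia.
rewrite [RHS]big_mkcond; apply: eq_bigr => i _ /=.
have -> : (i < (k - size s).+1)%N = (size s <= k - i)%N by have := ltn_ord i; lia.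
by case: ifPn => _; rewrite ?mule0// subnAC.
Qed.

End convolution.

(** * The branching property *)

Lemma integral_cst_probability d (T : measurableType d) (R : realType)
  (P : probability T R) (c : \bar R) : \int[P]_x cst c x = c.
Proof.
by rewrite integral_cst// -[RHS]mule1; congr (_ * _); exact: probability_setT.
Qed.

Section tuples.
Context d (T : measurableType d) (R : realType) (mu : probability T R).

Section tuple_power_cons.
Variables (n : nat) (F : n.+1.-tuple T -> \bar R).
Hypotheses (mF : measurable_fun [set: n.+1.-tuple T] F) (F0 : forall y, 0 <= F y).

Let mFc : measurable_fun setT (F \o @cons_pair _ T n).
Proof. exact: measurableT_comp mF (@measurable_cons_pair _ T n). Qed.

Let Fc0 p : 0 <= (F \o @cons_pair _ T n) p. Proof. exact: F0. Qed.

Lemma integral_tuple_cons : \int[tuple_power mu n.+1]_y F y =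
  \int[mu]_x \int[tuple_power mu n]_y F [tuple of x :: y].
Proof.
transitivity (\int[product_probability mu (tuple_power mu n)]_p F (cons_pair p)).
  exact: ge0_integral_distribution.
exact: (@fubini_tonelli1 _ _ _ _ _ mu (tuple_power mu n)).
Qed.

Lemma integral_tuple_cons_swap : \int[tuple_power mu n.+1]_y F y =
  \int[tuple_power mu n]_y \int[mu]_x F [tuple of x :: y].
Proof.
transitivity (\int[product_probability mu (tuple_power mu n)]_p F (cons_pair p)).
  exact: ge0_integral_distribution.
exact: (@fubini_tonelli2 _ _ _ _ _ mu (tuple_power mu n)).
Qed.

End tuple_power_cons.

Lemma measurable_convs (a : T -> nat -> \bar R) n k :
  (forall i, measurable_fun setT (a ^~ i)) ->
  measurable_fun [set: n.-tuple T] (fun y : n.-tuple T => convs a y k).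
Proof.
move=> ma; elim: n k => [|n IH] k.
  rewrite (_ : (fun _ => _) = cst (k == 0)%N%:R%:E); first exact: measurable_cst.
  by apply/funext => y; rewrite tuple0.
rewrite (_ : (fun _ => _) = fun y : n.+1.-tuple T => \sum_(i < k.+1)
    a (tnth y ord0) i * convs a [tuple of behead y] (k - i)); last first.
  by apply/funext => y; rewrite [in LHS](tuple_eta y).
apply: emeasurable_sum => i; apply: emeasurable_funM.
  exact: measurableT_comp (ma i) (@measurable_tnth _ T n.+1 ord0).
exact: measurableT_comp (IH _) (@measurable_behead _ T n).
Qed.

End tuples.

Section kernel_operator.
Context d (T : measurableType d) (R : realType) (mu : probability T R).

Definition Kop (W : T * T -> R) (u : T -> \bar R) x : \bar R :=
  \int[mu]_y ((W (x, y))%:E * u y).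

Variable W : T * T -> R.
Hypotheses (mW : measurable_fun setT W) (W0 : forall x y, (0 <= W (x, y))%R).

Lemma measurable_section x : measurable_fun setT (fun y => (W (x, y))%:E).
Proof. exact/measurable_EFinP/measurableT_comp. Qed.

Lemma measurable_kernel_tuple x n :
  measurable_fun [set: n.-tuple T] (fun y : n.-tuple T => (\prod_(i < n) W (x, tnth y i))%:E).
Proof.
apply: (@measurable_prod_tnth _ _ _ (fun y => W (x, y))).
exact/measurable_EFinP/measurable_section.
Qed.

Lemma kernel_tuple_ge0 x n (y : n.-tuple T) : 0 <= (\prod_(i < n) W (x, tnth y i))%:E.
Proof. by rewrite lee_fin prodr_ge0. Qed.

Lemma Kop_ge0 u x : (forall y, 0 <= u y) -> 0 <= Kop W u x.
Proof. by move=> u0; apply: integral_ge0 => y _; rewrite mule_ge0 ?lee_fin. Qed.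

Lemma measurable_Kop u : measurable_fun setT u -> (forall y, 0 <= u y) ->
  measurable_fun setT (Kop W u).
Proof.
move=> mu_ u0.
apply: (measurable_fun_fubini_tonelli_F (fun p : T * T => (W p)%:E * u p.2)).
  apply: emeasurable_funM; first exact/measurable_EFinP.
  exact: measurableT_comp mu_ measurable_snd.
by move=> [x y]; rewrite mule_ge0 ?lee_fin.
Qed.

(** The coordinates of y are independent, so by Tonelli the convolution may be
    integrated one coordinate at a time; each factor [a (tnth y j) i] becomes
    [Kop W (a ^~ i) x], whatever j is. *)
Lemma Kop_kernel_tuple x (a : T -> nat -> \bar R) n k :
  (forall i, measurable_fun setT (a ^~ i)) -> (forall x i, 0 <= a x i) ->
  \int[tuple_power mu n]_y ((\prod_(i < n) W (x, tnth y i))%:E * convs a y k) =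
  convs (fun _ : unit => fun i => Kop W (a ^~ i) x) (nseq n tt) k.
Proof.
move=> ma a0; have ca0 s i : 0 <= convs a s i by exact: convs_ge0.
elim: n k => [|n IH] k /=.
  rewrite (eq_integral (cst (k == 0)%N%:R%:E)) => [|y _]; last first.
    by rewrite big_ord0 mul1e tuple0.
  exact: integral_cst_probability.
have mc m i := @measurable_convs _ T R a m i ma.
rewrite integral_tuple_cons; last 2 first.
- by apply: emeasurable_funM; [exact: measurable_kernel_tuple|exact: mc].
- by move=> y; rewrite mule_ge0 ?kernel_tuple_ge0.
transitivity (\int[mu]_y \sum_(i < k.+1) ((W (x, y))%:E * a y i) *
    convs (fun _ : unit => fun i => Kop W (a ^~ i) x) (nseq n tt) (k - i)).
  apply: eq_integral => z _.
  rewrite (eq_integral (fun y : n.-tuple T => \sum_(i < k.+1)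
      ((W (x, z))%:E * a z i) *
      ((\prod_(j < n) W (x, tnth y j))%:E * convs a y (k - i)))); last first.
    move=> y _ /=; rewrite big_ord_recl EFinM.
    have -> : tnth [tuple of z :: y] ord0 = z by rewrite (tnth_nth z).
    under [X in _ * X%:E * _]eq_bigr => i _ do rewrite tnthS.
    rewrite ge0_sume_distrr; last by move=> i _; rewrite mule_ge0.
    by apply: eq_bigr => i _; rewrite muleACA.
  have mPc i : measurable_fun [set: n.-tuple T] (fun y : n.-tuple T =>
      (\prod_(j < n) W (x, tnth y j))%:E * convs a y (k - i)).
    by apply: emeasurable_funM; [exact: measurable_kernel_tuple|exact: mc].
  rewrite ge0_integral_sum//; last 2 first.
  - by move=> i; exact: measurable_funeM.
  - by move=> i y _; rewrite !mule_ge0 ?kernel_tuple_ge0 ?lee_fin.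
  apply: eq_bigr => i _; rewrite ge0_integralZl ?IH//.
  - by move=> y _; rewrite mule_ge0 ?kernel_tuple_ge0.
  - by rewrite mule_ge0 ?lee_fin.
have mWa i : measurable_fun setT (fun y => (W (x, y))%:E * a y i).
  by apply: emeasurable_funM; [exact: measurable_section|exact: ma].
have C0 m i : 0 <= convs (fun _ : unit => fun i => Kop W (a ^~ i) x) (nseq m tt) i.
  by apply: convs_ge0 => _ j; exact: Kop_ge0.
rewrite ge0_integral_sum//; last 2 first.
- by move=> i; under eq_fun do rewrite muleC; exact: measurable_funeM.
- by move=> i y _; rewrite !mule_ge0 ?lee_fin.
apply: eq_bigr => i _; rewrite ge0_integralZr//.
by move=> y _; rewrite mule_ge0 ?lee_fin.
Qed.

Lemma poisson_expectation_sum x (I : Type) (r : seq I) (c : I -> \bar R)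
    (h : I -> seq T -> \bar R) :
  (forall i, 0 <= c i) -> (forall i s, 0 <= h i s) ->
  (forall i n, measurable_fun [set: n.-tuple T] (fun y : n.-tuple T => h i y)) ->
  poisson_expectation mu W x (fun y => \sum_(i <- r) c i * h i y) =
  \sum_(i <- r) c i * poisson_expectation mu W x (h i).
Proof.
move=> c0 h0 mh.
have mPh i n : measurable_fun [set: n.-tuple T] (fun y : n.-tuple T =>
    (\prod_(j < n) W (x, tnth y j))%:E * h i y).
  by apply: emeasurable_funM; [exact: measurable_kernel_tuple|exact: mh].
have Ph0 i n (y : n.-tuple T) : 0 <= (\prod_(j < n) W (x, tnth y j))%:E * h i y.
  by rewrite mule_ge0 ?kernel_tuple_ge0.
have I0 i n : 0 <= (n`!%:R^-1)%:E *
    \int[tuple_power mu n]_y ((\prod_(j < n) W (x, tnth y j))%:E * h i y).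
  by rewrite mule_ge0 ?integral_ge0// lee_fin invr_ge0.
rewrite /poisson_expectation.
transitivity (expeR (- total_intensity mu W x) * \sum_(0 <= n <oo) \sum_(i <- r)
    c i * ((n`!%:R^-1)%:E *
      \int[tuple_power mu n]_y ((\prod_(j < n) W (x, tnth y j))%:E * h i y))).
  congr (_ * _); apply: eq_eseriesr => n _.
  rewrite (eq_integral (fun y : n.-tuple T => \sum_(i <- r)
      c i * ((\prod_(j < n) W (x, tnth y j))%:E * h i y))); last first.
    move=> y _; rewrite ge0_sume_distrr; last by move=> i _; rewrite mule_ge0.
    by apply: eq_bigr => i _; rewrite muleCA.
  rewrite ge0_integral_sum//; last 2 first.
  - by move=> i; apply: measurable_funeM; exact: mPh.
  - by move=> i y _; exact: mule_ge0.
  rewrite ge0_sume_distrr; last first.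
    by move=> i _; apply: integral_ge0 => y _; exact: mule_ge0.
  by apply: eq_bigr => i _; rewrite ge0_integralZl//; [rewrite muleCA|exact: mPh].
rewrite nneseries_sum; last by move=> i n _; rewrite mule_ge0.
rewrite ge0_sume_distrr; last first.
  by move=> i _; apply: nneseries_ge0 => n _ _; rewrite mule_ge0.
by apply: eq_bigr => i _; rewrite nneseriesZl_ereal// muleCA.
Qed.

Lemma poisson_expectation_ge0 x h : (forall s, 0 <= h s) ->
  0 <= poisson_expectation mu W x h.
Proof.
move=> h0; rewrite mule_ge0 ?expeR_ge0//; apply: nneseries_ge0 => n _ _.
rewrite mule_ge0 ?lee_fin ?invr_ge0//; apply: integral_ge0 => y _.
by rewrite mule_ge0 ?kernel_tuple_ge0.
Qed.

(** The offspring of distinct particles are independent, so the expected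
    convolution over all children is the convolution over the parents.  The
    combination with coefficients c is what the induction requires: fixing the
    children y of the first particle turns the convolution over [y ++ z] into a
    combination of convolutions over z, with coefficients depending on y. *)
Lemma offspring_expectation_convs (a : T -> nat -> \bar R) s :
  (forall i, measurable_fun setT (a ^~ i)) -> (forall x i, 0 <= a x i) ->
  forall (I : Type) (r : seq I) (c : I -> \bar R) (k : I -> nat),
  (forall i, 0 <= c i) ->
  offspring_expectation mu W s (fun z => \sum_(i <- r) c i * convs a z (k i)) =
  \sum_(i <- r) c i *
    convs (fun x k => poisson_expectation mu W x (fun y => convs a y k)) s (k i).
Proof.
move=> ma a0; have c0 s' i : 0 <= convs a s' i by exact: convs_ge0.
set b := fun x k => poisson_expectation mu W x (fun y => convs a y k).
have b0 x i : 0 <= b x i by exact: poisson_expectation_ge0.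
have cb0 s' i : 0 <= convs b s' i by exact: convs_ge0.
elim: s => [|x s IH] I r c k r0 //=.
pose r' := [seq (i, j) | i <- r, j <- iota 0 (k i).+1].
transitivity (poisson_expectation mu W x (fun y => \sum_(p <- r')
    (c p.1 * convs b s (k p.1 - p.2)) * convs a y p.2)).
  congr (poisson_expectation mu W x); apply/funext => y.
  transitivity (offspring_expectation mu W s (fun z => \sum_(p <- r')
      (c p.1 * convs a y p.2) * convs a z (k p.1 - p.2))).
    congr (offspring_expectation mu W s); apply/funext => z.
    rewrite big_allpairs_dep; apply: eq_bigr => i _.
    rewrite convs_cat// ge0_sume_distrr; last by move=> j _; rewrite mule_ge0.
    rewrite -[iota 0 _]/(index_iota 0 (k i).+1) big_mkord.
    by apply: eq_bigr => j _; rewrite muleA.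
  rewrite (IH _ r' (fun p => c p.1 * convs a y p.2) (fun p => k p.1 - p.2)%N).
    by apply: eq_bigr => p _; rewrite muleAC.
  by move=> p; rewrite mule_ge0.
rewrite (@poisson_expectation_sum x _ r' (fun p => c p.1 * convs b s (k p.1 - p.2))
  (fun p y => convs a y p.2))//; last 2 first.
- by move=> p; rewrite mule_ge0.
- by move=> p n; exact: measurable_convs.
rewrite big_allpairs_dep; apply: eq_bigr => i _.
rewrite ge0_sume_distrr; last by move=> j _; rewrite mule_ge0.
rewrite -[iota 0 _]/(index_iota 0 (k i).+1) big_mkord.
by apply: eq_bigr => j _; rewrite -/(b x j) -muleA [convs b s _ * _]muleC.
Qed.

(** The probability that the process started from one particle of type x is
    extinct by generation n and has k particles in total. *)
Fixpoint progeny_by (n : nat) : T -> nat -> \bar R :=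
  if n is m.+1 then
    shift (fun x k => poisson_expectation mu W x (fun y => convs (progeny_by m) y k))
  else fun _ _ => 0.

Lemma progeny_by_ge0 n x k : 0 <= progeny_by n x k.
Proof.
elim: n x k => [|n IH] x [|k] //=; apply: poisson_expectation_ge0 => s.
exact: convs_ge0.
Qed.

Lemma offspring_expectation0 s : offspring_expectation mu W s (fun=> 0) = 0.
Proof.
elim: s => //= x s IH.
under [X in poisson_expectation _ _ _ X]eq_fun do rewrite IH.
rewrite /poisson_expectation eseries0 ?mule0// => n _ _.
by under eq_integral do rewrite mule0; rewrite integral0 mule0.
Qed.

Lemma generations_expectation0 n s : generations_expectation mu W n s (fun=> 0) = 0.
Proof.
elim: n s => //= n IH s.
under [X in offspring_expectation _ _ _ X]eq_fun do rewrite IH.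
exact: offspring_expectation0.
Qed.

Lemma eq_generations_expectation n s h h' :
  (forall s' Z, h (s' :: Z) = h' (s' :: Z)) ->
  generations_expectation mu W n s h = generations_expectation mu W n s h'.
Proof.
elim: n s h h' => [|n IH] s h h' hh' /=; first exact: hh'.
congr (offspring_expectation mu W s); apply/funext => s'.
by congr (generations_expectation mu W n s'); apply/funext => Z.
Qed.

(** The branching property: the processes started from the particles of s are
    independent, so their total progenies add up by convolution. *)
Lemma generations_expectation_convs n s k :
  (forall m i, measurable_fun setT ((progeny_by m) ^~ i)) ->
  generations_expectation mu W n s (fun Z => (extinct_with_progeny k Z)%:R%:E) =
  convs (progeny_by n) s k.
Proof.
move=> ma; elim: n s k => [|n IH] s k.
  rewrite /= /extinct_with_progeny /=.
  by case: s => [|x s] /=; [rewrite eq_sym|rewrite big1// => i _; rewrite mul0e].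
rewrite [progeny_by n.+1]/= convs_shift /=.
transitivity (offspring_expectation mu W s (fun s' =>
    if (size s <= k)%N then convs (progeny_by n) s' (k - size s) else 0)).
  congr (offspring_expectation mu W s); apply/funext => s'; rewrite -IH.
  transitivity (generations_expectation mu W n s' (fun Z =>
      ((size s <= k)%N && extinct_with_progeny (k - size s) Z)%:R%:E)).
    apply: eq_generations_expectation => z Z.
    rewrite /extinct_with_progeny /= andbCA; congr (_ && _)%:R%:E.
    by lia.
  by case: ifP => _ //=; exact: generations_expectation0.
case: ifP => _; last exact: offspring_expectation0.
have := @offspring_expectation_convs _ s (ma n) (progeny_by_ge0 n) unit [:: tt]
  (fun _ => 1) (fun _ => k - size s)%N (fun _ => lee01).
rewrite big_seq1 mul1e => <-; congr (offspring_expectation mu W s).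
by apply/funext => z; rewrite big_seq1 mul1e.
Qed.

End kernel_operator.

(** * Tree moments and their multipliers *)

(** Rooted plane trees: [Graft t1 t2] attaches the root of t2 to the root of t1 by
    a new edge. *)
Inductive rtree : Type := Leaf | Graft of rtree & rtree.

(** Gluing two trees at their roots. *)
Fixpoint merge s t := if t is Graft t1 t2 then Graft (merge s t1) t2 else s.

Section nonneg_measurable.
Context d (T : measurableType d) (R : realType).
Implicit Types u v : T -> \bar R.

Record nnm u : Prop := Nnm {
  nnm_measurable : measurable_fun setT u ;
  nnm_ge0 : forall x, 0 <= u x }.

Lemma nnm_cst (c : R) : (0 <= c)%R -> nnm (cst c%:E).
Proof. by move=> c0; split => [|x]; [exact: measurable_cst|rewrite lee_fin]. Qed.

Lemma nnmM u v : nnm u -> nnm v -> nnm (u \* v).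
Proof.
move=> [mu_ u0] [mv v0]; split => [|x]; first exact: emeasurable_funM.
by rewrite mule_ge0.
Qed.

Lemma nnmD u v : nnm u -> nnm v -> nnm (u \+ v).
Proof.
move=> [mu_ u0] [mv v0]; split => [|x]; first exact: emeasurable_funD.
by rewrite adde_ge0.
Qed.

End nonneg_measurable.

Section bounded_kernel.
Context d (T : measurableType d) (R : realType) (mu : probability T R).

(** Essential boundedness in operator form: if W(x,.) <= C almost everywhere for
    almost every x, then [Kop W] maps L^1 to L^oo with norm at most C. *)
Record bounded_kernel (W : T * T -> R) (C : R) : Prop := BoundedKernel {
  bk_measurable : measurable_fun setT W ;
  bk_ge0 : forall x y, (0 <= W (x, y))%R ;
  bk_sym : forall x y, W (x, y) = W (y, x) ;
  bk_bound_ge0 : (0 <= C)%R ;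
  bk_bound : forall u, nnm u -> {ae mu, forall x, Kop mu W u x <= C%:E * \int[mu]_y u y} }.

Variables (W : T * T -> R) (C : R) (bW : bounded_kernel W C).
Let mW := bk_measurable bW.
Let W0 := bk_ge0 bW.

Lemma nnm_Kop u : nnm u -> nnm (Kop mu W u).
Proof.
move=> [mu_ u0]; split => [|x]; first exact: measurable_Kop.
exact: Kop_ge0.
Qed.

Lemma Kop_selfadjoint u v : nnm u -> nnm v ->
  \int[mu]_x (Kop mu W u x * v x) = \int[mu]_x (u x * Kop mu W v x).
Proof.
move=> [mu_ u0] [mv v0].
have mWx x := measurable_section mW x.
transitivity (\int[mu]_x \int[mu]_y ((W (x, y))%:E * u y * v x)).
  apply: eq_integral => x _; rewrite ge0_integralZr//.
  - exact: emeasurable_funM.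
  - by move=> y _; rewrite mule_ge0 ?lee_fin.
rewrite (fubini_tonelli (fun p : T * T => (W p)%:E * u p.2 * v p.1))/=; first last.
- by move=> [x y] /=; rewrite !mule_ge0 ?lee_fin.
- apply: emeasurable_funM; last exact: measurableT_comp mv measurable_fst.
  apply: emeasurable_funM; first exact/measurable_EFinP.
  exact: measurableT_comp mu_ measurable_snd.
apply: eq_integral => y _.
rewrite /Kop -ge0_integralZl//.
- by apply: eq_integral => x _; rewrite (bk_sym bW) muleAC muleC.
- exact: emeasurable_funM.
- by move=> x _; rewrite mule_ge0 ?lee_fin.
Qed.

(** The density of t in W when the type of the root is prescribed. *)
Fixpoint tau t : T -> \bar R :=
  if t is Graft t1 t2 then tau t1 \* Kop mu W (tau t2) else cst 1.

Lemma nnm_tau t : nnm (tau t).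
Proof.
elim: t => [|t1 IH1 t2 IH2] /=; first exact: nnm_cst.
by apply: nnmM => //; exact: nnm_Kop.
Qed.

(** Moving [Kop W] to the other side hangs t on a new root. *)
Lemma Kop_tau t u : nnm u ->
  \int[mu]_x (Kop mu W u x * tau t x) = \int[mu]_x (u x * tau (Graft Leaf t) x).
Proof.
move=> nu; rewrite (Kop_selfadjoint nu (nnm_tau t)).
by apply: eq_integral => x _ /=; rewrite mul1e.
Qed.

Lemma tau_merge s t x : tau (merge s t) x = tau s x * tau t x.
Proof.
elim: t => [|t1 IH1 t2 IH2] /=; first by rewrite mule1.
by rewrite IH1 muleA.
Qed.

Lemma tau_bounded t : exists M : R, (0 <= M)%R /\ {ae mu, forall x, tau t x <= M%:E}.
Proof.
elim: t => [|t1 [M1 [M10 H1]] t2 [M2 [M20 H2]]] /=.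
  exists 1%R; split; first exact: ler01.
  by apply: aeW => x; exact: lexx.
exists (M1 * (C * M2))%R; split; first by rewrite !mulr_ge0// (bk_bound_ge0 bW).
have [m2 t20] := nnm_tau t2.
have i2 : \int[mu]_y tau t2 y <= M2%:E.
  apply: (@le_trans _ _ (\int[mu]_y (cst M2%:E) y)).
    apply: ae_ge0_le_integral => //; last by move: H2; apply: filterS.
  by rewrite integral_cst_probability.
move: H1 (bk_bound bW (nnm_tau t2)); apply: filterS2 => x h1 h2.
have [_ t10] := nnm_tau t1; have [_ K0] := nnm_Kop (nnm_tau t2).
rewrite EFinM; apply: lee_pmul => //; rewrite EFinM.
by apply: (le_trans h2); rewrite lee_wpmul2l// lee_fin (bk_bound_ge0 bW).
Qed.

Lemma tau_integral_lty t : \int[mu]_x tau t x < +oo.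
Proof.
have [M [M0 H]] := tau_bounded t; have [mt t0] := nnm_tau t.
apply: (@le_lt_trans _ _ (\int[mu]_y (cst M%:E) y)).
  by apply: ae_ge0_le_integral => //; move: H; apply: filterS.
by rewrite integral_cst_probability ltry.
Qed.

End bounded_kernel.

Section multipliers.
Context d (T : measurableType d) (R : realType) (mu : probability T R).
Variables (A B : T * T -> R) (CA CB : R).
Hypotheses (bA : bounded_kernel mu A CA) (bB : bounded_kernel mu B CB).
Hypothesis same_tau : forall t, \int[mu]_x tau mu A t x = \int[mu]_x tau mu B t x.

Record same_moments (u w : T -> \bar R) : Prop := SameMoments {
  same_moments_nnml : nnm u ;
  same_moments_nnmr : nnm w ;
  same_momentsE : forall t,
    \int[mu]_x (u x * tau mu A t x) = \int[mu]_x (w x * tau mu B t x) /\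
    \int[mu]_x (u x * tau mu A t x) < +oo }.

(** Testing against all pairs with the same moments makes products trivial, which
    they are not for [same_moments] itself. *)
Record multiplier (u w : T -> \bar R) : Prop := Multiplier {
  multiplier_nnml : nnm u ;
  multiplier_nnmr : nnm w ;
  multiplierE : forall v v', same_moments v v' -> same_moments (u \* v) (w \* v') }.

Lemma same_moments1 : same_moments (cst 1) (cst 1).
Proof.
split; [exact: nnm_cst|exact: nnm_cst|move=> t].
under eq_integral do rewrite mul1e; under [in RHS]eq_integral do rewrite mul1e.
by split=> //; exact: (tau_integral_lty bA).
Qed.

Lemma same_moments_integral u w : same_moments u w ->
  \int[mu]_x u x = \int[mu]_x w x /\ \int[mu]_x u x < +oo.
Proof.
case=> _ _ /(_ Leaf)/=; under eq_integral do rewrite mule1.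
by under [in RHS]eq_integral do rewrite mule1.
Qed.

Lemma multiplier_integral u w : multiplier u w ->
  \int[mu]_x u x = \int[mu]_x w x.
Proof.
case=> _ _ /(_ _ _ same_moments1)/same_moments_integral[+ _] => /=.
by under eq_integral do rewrite mule1; under [in RHS]eq_integral do rewrite mule1.
Qed.

Lemma same_moments_tau u w t : same_moments u w ->
  same_moments (u \* tau mu A t) (w \* tau mu B t).
Proof.
move=> [nu nw H].
split; [exact: nnmM nu (nnm_tau bA t)|exact: nnmM nw (nnm_tau bB t)|move=> s].
have := H (merge t s).
under eq_integral do rewrite tau_merge muleA.
by under [in RHS]eq_integral do rewrite tau_merge muleA.
Qed.

Lemma same_moments_Kop u w : same_moments u w ->
  same_moments (Kop mu A u) (Kop mu B w).
Proof.
move=> [nu nw H]; split; [exact: nnm_Kop bA _ _|exact: nnm_Kop bB _ _|move=> t].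
have [e f] := H (Graft Leaf t).
have eA := Kop_tau bA t nu; have eB := Kop_tau bB t nw.
split; first exact: etrans eA (etrans e (esym eB)).
by rewrite eA.
Qed.

(** Equality of plain integrals suffices, since the test pair (v, v') may absorb
    any tree. *)
Lemma multiplier_same_moments u w :
  nnm u -> nnm w ->
  (forall v v', same_moments v v' ->
    \int[mu]_x (u x * v x) = \int[mu]_x (w x * v' x) /\
    \int[mu]_x (u x * v x) < +oo) -> multiplier u w.
Proof.
move=> nu nw H; split; [exact: nu|exact: nw|].
move=> v v' vv'.
have [nv nv' _] := vv'.
split; [exact: nnmM|exact: nnmM|].
move=> t.
have := H _ _ (same_moments_tau t vv').
under eq_integral do rewrite muleA.
by under [in RHS]eq_integral do rewrite muleA.
Qed.

Lemma eq_multiplier u w u' w' : u =1 u' -> w =1 w' ->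
  multiplier u w -> multiplier u' w'.
Proof. by move=> /funext -> /funext ->. Qed.

Lemma multiplier_cst (c : R) : (0 <= c)%R -> multiplier (cst c%:E) (cst c%:E).
Proof.
move=> c0; apply: multiplier_same_moments; [exact: nnm_cst|exact: nnm_cst|].
move=> v v' vv'; have [[mv v0] [mv' v'0] _] := vv'.
have [e f] := same_moments_integral vv'.
rewrite !ge0_integralZl//= e; split=> //.
rewrite -e; move: f; rewrite -ge0_fin_numE; last exact: integral_ge0.
by move=> /fineK <-; rewrite -EFinM ltry.
Qed.

Lemma multiplierM u w u' w' : multiplier u w -> multiplier u' w' ->
  multiplier (u \* u') (w \* w').
Proof.
move=> [nu nw H] [nu' nw' H']; split; [exact: nnmM|exact: nnmM|].
move=> v v' vv'.
have muleA_fun (f g h : T -> \bar R) : (f \* g) \* h = f \* (g \* h).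
  by apply/funext => x /=; rewrite muleA.
by rewrite !muleA_fun; apply: H; apply: H'.
Qed.

Lemma multiplierD u w u' w' : multiplier u w -> multiplier u' w' ->
  multiplier (u \+ u') (w \+ w').
Proof.
move=> [nu nw H] [nu' nw' H'].
apply: multiplier_same_moments; [exact: nnmD|exact: nnmD|move=> v v' vv'].
have [[mv v0] [mv' v'0] _] := vv'.
have [e f] := same_moments_integral (H _ _ vv').
have [e' f'] := same_moments_integral (H' _ _ vv').
case: nu nw nu' nw' => [mu_ u0] [mw w0] [mu' u'0] [mw' w'0].
have -> : \int[mu]_x ((u \+ u') x * v x) =
    \int[mu]_x (u x * v x) + \int[mu]_x (u' x * v x).
  rewrite -ge0_integralD//; try by [exact: emeasurable_funM|move=> x _; rewrite mule_ge0].
  by apply: eq_integral => x _; rewrite ge0_muleDl.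
have -> : \int[mu]_x ((w \+ w') x * v' x) =
    \int[mu]_x (w x * v' x) + \int[mu]_x (w' x * v' x).
  rewrite -ge0_integralD//; try by [exact: emeasurable_funM|move=> x _; rewrite mule_ge0].
  by apply: eq_integral => x _; rewrite ge0_muleDl.
by split; [congr (_ + _)|exact: lte_add_pinfty].
Qed.

Lemma multiplier_sum (I : Type) (r : seq I) (u w : I -> T -> \bar R) :
  (forall i, multiplier (u i) (w i)) ->
  multiplier (fun x => \sum_(i <- r) u i x) (fun x => \sum_(i <- r) w i x).
Proof.
move=> H; elim: r => [|i r IH].
  by apply: (eq_multiplier _ _ (multiplier_cst (lexx 0%R))) => x; rewrite big_nil.
by apply: (eq_multiplier _ _ (multiplierD (H i) IH)) => x; rewrite big_cons.
Qed.

(** By self-adjointness the integral of (K u) v equals that of u (K v), and (K v,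
    K v') has the same moments as soon as (v, v') does. *)
Lemma multiplier_Kop u w : multiplier u w -> multiplier (Kop mu A u) (Kop mu B w).
Proof.
move=> [nu nw H].
apply: multiplier_same_moments; [exact: nnm_Kop bA _ _|exact: nnm_Kop bB _ _|].
move=> v v' vv'; have [nv nv' _] := vv'.
have [e f] := same_moments_integral (H _ _ (same_moments_Kop vv')).
have eA := Kop_selfadjoint bA nu nv; have eB := Kop_selfadjoint bB nw nv'.
split; first exact: etrans eA (etrans e (esym eB)).
by rewrite eA.
Qed.

Lemma multiplier_ae u w u' w' : multiplier u w -> nnm u' -> nnm w' ->
  {ae mu, forall x, u x = u' x} -> {ae mu, forall x, w x = w' x} ->
  multiplier u' w'.
Proof.
move=> [[mu_ u0] [mw w0] H] [mu' u'0] [mw' w'0] uu' ww'.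
apply: multiplier_same_moments => // v v' vv'.
have [[mv v0] [mv' v'0] _] := vv'.
have [e f] := same_moments_integral (H _ _ vv').
have <- : \int[mu]_x (u x * v x) = \int[mu]_x (u' x * v x).
  apply: ge0_ae_eq_integral => //; try exact: emeasurable_funM.
  - by move=> x _; rewrite mule_ge0.
  - by move=> x _; rewrite mule_ge0.
  - by move: uu'; apply: filterS => x -> _.
have <- // : \int[mu]_x (w x * v' x) = \int[mu]_x (w' x * v' x).
apply: ge0_ae_eq_integral => //; try exact: emeasurable_funM.
- by move=> x _; rewrite mule_ge0.
- by move=> x _; rewrite mule_ge0.
- by move: ww'; apply: filterS => x -> _.
Qed.

Let nnm_cst_sub (C : R) (u : T -> \bar R) : nnm u -> (forall x, u x <= C%:E) ->
  nnm (fun x => C%:E - u x).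
Proof.
move=> [mu_ u0] uC; split=> [|x]; last by rewrite subre_ge0.
by apply: emeasurable_funB => //; exact: measurable_cst.
Qed.

Let integral_cst_sub (C : R) (u v : T -> \bar R) : (0 <= C)%R -> nnm u -> nnm v ->
  (forall x, u x <= C%:E) -> \int[mu]_x v x < +oo ->
  \int[mu]_x ((C%:E - u x) * v x) =
    C%:E * \int[mu]_x v x - \int[mu]_x (u x * v x) /\
  \int[mu]_x ((C%:E - u x) * v x) < +oo.
Proof.
move=> C0 nu nv uC fv; have [mcu cu0] := nnm_cst_sub nu uC.
case: nu nv => [mu_ u0] [mv v0].
have E : \int[mu]_x ((C%:E - u x) * v x) + \int[mu]_x (u x * v x) =
    C%:E * \int[mu]_x v x.
  rewrite -ge0_integralD//; last 4 first.
  - by move=> x _; rewrite mule_ge0.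
  - exact: (emeasurable_funM mcu).
  - by move=> x _; rewrite mule_ge0.
  - exact: emeasurable_funM.
  rewrite -ge0_integralZl//; apply: eq_integral => x _.
  rewrite -ge0_muleDl// subeK//.
  by rewrite ge0_fin_numE// (le_lt_trans (uC x)) ?ltry.
have fCv : C%:E * \int[mu]_x v x < +oo.
  move: fv; rewrite -ge0_fin_numE; last exact: integral_ge0.
  by move=> /fineK <-; rewrite -EFinM ltry.
have i1 : 0 <= \int[mu]_x ((C%:E - u x) * v x).
  by apply: integral_ge0 => x _; rewrite mule_ge0.
have i2 : 0 <= \int[mu]_x (u x * v x).
  by apply: integral_ge0 => x _; rewrite mule_ge0.
split; last by apply: le_lt_trans fCv; rewrite -E leeDl.
rewrite -E addeK// ge0_fin_numE//; apply: le_lt_trans fCv.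
by rewrite -E leeDr.
Qed.

Lemma multiplier_sub (C : R) u w : (0 <= C)%R -> multiplier u w ->
  (forall x, u x <= C%:E) -> (forall x, w x <= C%:E) ->
  multiplier (fun x => C%:E - u x) (fun x => C%:E - w x).
Proof.
move=> C0 [nu nw H] uC wC.
apply: multiplier_same_moments; [exact: nnm_cst_sub|exact: nnm_cst_sub|].
move=> v v' vv'; have [nv nv' _] := vv'.
have [e f] := same_moments_integral (H _ _ vv').
have [e' f'] := same_moments_integral vv'.
have [-> fA] := integral_cst_sub C0 nu nv uC f'; split.
  have f'' : \int[mu]_x v' x < +oo by rewrite -e'.
  by have [->] := integral_cst_sub C0 nw nv' wC f''; rewrite -e -e'.
by have [<-] := integral_cst_sub C0 nu nv uC f'.
Qed.

(** The bound M only serves to keep the moments finite. *)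
Lemma multiplier_series (M : R) (u w : nat -> T -> \bar R) :
  (0 <= M)%R -> (forall n, multiplier (u n) (w n)) ->
  (forall x, \sum_(0 <= n <oo) u n x <= M%:E) ->
  multiplier (fun x => \sum_(0 <= n <oo) u n x) (fun x => \sum_(0 <= n <oo) w n x).
Proof.
move=> M0 H uM.
have nu n : nnm (u n) by have [] := H n.
have nw n : nnm (w n) by have [] := H n.
have ns (f : nat -> T -> \bar R) : (forall n, nnm (f n)) ->
    nnm (fun x => \sum_(0 <= n <oo) f n x).
  move=> nf; split=> [|x]; last by apply: nneseries_ge0 => n _ _; have [] := nf n.
  by apply: ge0_emeasurable_sum => [n x _ _|n _]; have [] := nf n.
apply: multiplier_same_moments; [exact: ns|exact: ns|move=> v v' vv'].
have [[mv v0] [mv' v'0] _] := vv'.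
have swap (f : nat -> T -> \bar R) g : (forall n, nnm (f n)) -> nnm g ->
    \int[mu]_x ((\sum_(0 <= n <oo) f n x) * g x) =
    \sum_(0 <= n <oo) \int[mu]_x (f n x * g x).
  move=> nf [mg g0]; rewrite -integral_nneseries//.
  - apply: eq_integral => x _; rewrite muleC -nneseriesZl_ereal//.
      by apply: eq_eseriesr => n _; rewrite muleC.
    by move=> n; have [] := nf n.
  - by move=> n; apply: emeasurable_funM => //; have [] := nf n.
  - by move=> n x _; rewrite mule_ge0//; have [] := nf n.
have [nv nv' _] := vv'; split.
  rewrite !swap//; apply: eq_eseriesr => n _; have [_ _ Hn] := H n.
  by have [] := same_moments_integral (Hn _ _ vv').
have [_ _ HM] := multiplier_cst M0.
have [_ fM] := same_moments_integral (HM _ _ vv').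
apply: le_lt_trans fM; have [ms s0] := ns _ nu.
apply: ge0_le_integral => //.
- by move=> x _; rewrite mule_ge0.
- exact: emeasurable_funM.
- exact: measurable_funeM.
- by move=> x _; rewrite lee_wpmul2r.
Qed.

Lemma multiplier_expR (M : R) (u w : T -> R) :
  (forall x, 0 <= u x <= M)%R -> (forall x, 0 <= w x <= M)%R ->
  multiplier (EFin \o u) (EFin \o w) ->
  multiplier (fun x => (expR (u x))%:E) (fun x => (expR (w x))%:E).
Proof.
move=> uM wM H.
have E (z : R) : (0 <= z)%R ->
    (expR z)%:E = \sum_(0 <= n <oo) (n`!%:R^-1)%:E * (z ^+ n)%:E.
  move=> z0; rewrite /expR -EFin_lim; last exact: is_cvg_series_exp_coeff.
  apply/congr_lim/funext => n /=; rewrite /series /= -sumEFin.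
  by apply: eq_bigr => i _; rewrite -EFinM mulrC.
have HX n : multiplier (fun x => (u x ^+ n)%:E) (fun x => (w x ^+ n)%:E).
  elim: n => [|n IH]; first exact: multiplier_cst.
  by apply: (eq_multiplier _ _ (multiplierM H IH)) => x /=; rewrite -EFinM exprS.
have HS : multiplier
    (fun x => \sum_(0 <= n <oo) (n`!%:R^-1)%:E * (u x ^+ n)%:E)
    (fun x => \sum_(0 <= n <oo) (n`!%:R^-1)%:E * (w x ^+ n)%:E).
  apply: (multiplier_series (expR_ge0 M)
    (u := fun n x => (n`!%:R^-1)%:E * (u x ^+ n)%:E)
    (w := fun n x => (n`!%:R^-1)%:E * (w x ^+ n)%:E)) => [n|x].
    apply: (multiplierM _ (HX n)); apply: multiplier_cst.
    by rewrite invr_ge0.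
  by have /andP[u0 uM'] := uM x; rewrite -E// lee_fin ler_expR.
apply: (eq_multiplier _ _ HS) => x; rewrite -E//.
  by have /andP[] := uM x.
by have /andP[] := wM x.
Qed.

(** The power series of exp(- d) alternates, which nonnegative functions do not
    allow; instead, exp(- d) = exp(- C) exp(C - d) for an upper bound C of both
    degree functions, and C - d is nonnegative.  The degrees are at most C only
    almost everywhere, hence the truncation. *)
Lemma multiplier_exp_total_intensity :
  multiplier (fun x => expeR (- total_intensity mu A x))
             (fun x => expeR (- total_intensity mu B x)).
Proof.
have iE (W : T * T -> R) : total_intensity mu W = Kop mu W (cst 1).
  by apply/funext => x; apply: eq_integral => y _; rewrite mule1.
rewrite !iE.
set C := Num.max CA CB.
have C0 : (0 <= C)%R by rewrite le_max (bk_bound_ge0 bA).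
have n1 : nnm (cst 1 : T -> \bar R) by exact: nnm_cst.
have HK : multiplier (Kop mu A (cst 1)) (Kop mu B (cst 1)).
  by apply: multiplier_Kop; exact: multiplier_cst.
pose trunc (W : T * T -> R) x := mine (Kop mu W (cst 1) x) C%:E.
have trunc_le W x : trunc W x <= C%:E by rewrite ge_min lexx orbT.
have ntrunc W CW : bounded_kernel mu W CW -> nnm (trunc W).
  move=> bW; have [mK K0] := nnm_Kop bW n1; split.
    by apply: measurable_mine => //; exact: measurable_cst.
  by move=> x; rewrite le_min K0 lee_fin.
have trunc_ae W CW : bounded_kernel mu W CW -> (CW <= C)%R ->
    {ae mu, forall x, Kop mu W (cst 1) x = trunc W x}.
  move=> bW CWC; move: (bk_bound bW n1); apply: filterS => x.
  rewrite integral_cst_probability mule1 => Kx; rewrite /trunc min_l//.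
  by rewrite (le_trans Kx)// lee_fin.
have CAC : (CA <= C)%R by rewrite le_max lexx.
have CBC : (CB <= C)%R by rewrite le_max lexx orbT.
have Ht : multiplier (trunc A) (trunc B).
  by apply: (multiplier_ae HK); [exact: ntrunc bA|exact: ntrunc bB
    |exact: trunc_ae bA CAC|exact: trunc_ae bB CBC].
have ft W CW : bounded_kernel mu W CW -> forall x, trunc W x \is a fin_num.
  move=> bW x; have [_ t0] := ntrunc _ _ bW.
  by rewrite ge0_fin_numE// (le_lt_trans (trunc_le W x)) ?ltry.
pose g W x := (C - fine (trunc W x))%R.
have gE W CW : bounded_kernel mu W CW -> EFin \o g W = fun x => C%:E - trunc W x.
  by move=> bW; apply/funext => x; rewrite /= EFinB fineK// (ft _ _ bW).
have gC W CW : bounded_kernel mu W CW -> forall x, (0 <= g W x <= C)%R.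
  move=> bW x; have [_ t0] := ntrunc _ _ bW.
  rewrite /g subr_ge0 gerBl -!lee_fin fineK ?(ft _ _ bW)// trunc_le.
  exact: t0.
have He : multiplier (fun x => (expR (g A x))%:E) (fun x => (expR (g B x))%:E).
  apply: (multiplier_expR (gC _ _ bA) (gC _ _ bB)).
  by rewrite (gE _ _ bA) (gE _ _ bB); exact: multiplier_sub.
have := multiplierM (multiplier_cst (expR_ge0 (- C))) He.
have nexp W CW : bounded_kernel mu W CW ->
    nnm (fun x => expeR (- Kop mu W (cst 1) x)).
  move=> bW; split=> [|x]; last exact: expeR_ge0.
  have [mK K0] := nnm_Kop bW n1.
  rewrite (_ : (fun _ => _) = fun x => if Kop mu W (cst 1) x == +oo then 0
      else (expR (- fine (Kop mu W (cst 1%E) x)))%:E); last first.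
    apply/funext => x; have [->//|Kx] := eqVneq (Kop mu W (cst 1) x) +oo.
    have Kf : Kop mu W (cst 1) x \is a fin_num by rewrite ge0_fin_numE// ltey.
    by rewrite -[in LHS](fineK Kf).
  apply: measurable_fun_ifT; [|exact: measurable_cst|].
    by apply: measurable_fun_eqe => //; exact: measurable_cst.
  apply/measurable_EFinP; apply: measurableT_comp => //.
  by apply: measurableT_comp => //; exact: measurableT_comp.
have ae W CW : bounded_kernel mu W CW -> (CW <= C)%R ->
    {ae mu, forall x, (cst (expR (- C))%:E \* (fun x => (expR (g W x))%:E)) x =
      expeR (- Kop mu W (cst 1) x)}.
  move=> bW CWC; move: (trunc_ae _ _ bW CWC); apply: filterS => x -> /=.
  rewrite -EFinM -expRD /g addrA addNr add0r.
  by rewrite -[in RHS](fineK (ft _ _ bW x)).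
move=> HH; apply: (multiplier_ae HH).
- exact: nexp bA.
- exact: nexp bB.
- exact: ae bA CAC.
- exact: ae bB CBC.
Qed.

End multipliers.

(** * Kernels with equal tree densities have the same progeny *)

Lemma convs_oversize (R : realType) (X : Type) (a : X -> nat -> \bar R) s k :
  (forall x, a x 0%N = 0) -> (k < size s)%N -> convs a s k = 0.
Proof.
move=> a00 ks; rewrite (_ : a = shift (fun x i => a x i.+1)); last first.
  by apply/funext => x; apply/funext => -[|i] //=.
by rewrite convs_shift leqNgt ks.
Qed.

(** Conditioning on the number m of points.  The sum over m stops at k because
    every point contributes at least 1. *)
Lemma poisson_expectation_convs d (T : measurableType d) (R : realType)
    (mu : probability T R) (W : T * T -> R) (a : T -> nat -> \bar R) x k :
  measurable_fun setT W -> (forall x y, (0 <= W (x, y))%R) ->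
  (forall i, measurable_fun setT (a ^~ i)) -> (forall x i, 0 <= a x i) ->
  (forall x, a x 0%N = 0) ->
  poisson_expectation mu W x (fun y => convs a y k) =
  expeR (- total_intensity mu W x) * \sum_(m < k.+1) (m`!%:R^-1)%:E *
    convs (fun _ : unit => fun i => Kop mu W (a ^~ i) x) (nseq m tt) k.
Proof.
move=> mW W0 ma a0 a00; rewrite /poisson_expectation; congr (_ * _).
under eq_eseriesr => m _ do rewrite (Kop_kernel_tuple _ mW W0)//.
rewrite (nneseries_split 0 k.+1) => [|m _]; last first.
  rewrite mule_ge0 ?lee_fin ?invr_ge0//; apply: convs_ge0 => _ i.
  exact: Kop_ge0.
rewrite add0n eseries0 ?adde0 ?big_mkord// => m km _.
rewrite convs_oversize ?mule0 ?size_nseq// => _.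
rewrite /Kop (eq_integral (cst 0)) ?integral0// => y _.
by rewrite a00 mule0.
Qed.

Section same_progeny.
Context d (T : measurableType d) (R : realType) (mu : probability T R).
Variables (A B : T * T -> R) (CA CB : R).
Hypotheses (bA : bounded_kernel mu A CA) (bB : bounded_kernel mu B CB).
Hypothesis same_tau : forall t, \int[mu]_x tau mu A t x = \int[mu]_x tau mu B t x.

Lemma multiplier_convs (X : Type) (a b : T -> X -> nat -> \bar R) s k :
  (forall y i, multiplier mu A B (fun x => a x y i) (fun x => b x y i)) ->
  multiplier mu A B (fun x => convs (a x) s k) (fun x => convs (b x) s k).
Proof.
move=> H; elim: s k => [|y s IH] k /=; first exact: (multiplier_cst bA bB (ler0n R (k == 0)%N)).
apply: (multiplier_sum bA bB) => i.
by apply: (multiplierM (H y i)).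
Qed.

(** The recursion expresses [progeny_by n.+1] by operations that preserve
    multipliers. *)
Lemma multiplier_progeny_by n k : multiplier mu A B
  (fun x => progeny_by mu A n x k) (fun x => progeny_by mu B n x k).
Proof.
have M0 := multiplier_cst bA bB (lexx 0%R).
elim: n k => [|n IH] [|k]; try exact: M0.
have [mA A0] := (bk_measurable bA, bk_ge0 bA).
have [mB B0] := (bk_measurable bB, bk_ge0 bB).
have ma i : measurable_fun setT (progeny_by mu A n ^~ i) by have [[]] := IH i.
have mb i : measurable_fun setT (progeny_by mu B n ^~ i) by have [_ []] := IH i.
have a0 x i : 0 <= progeny_by mu A n x i by exact: progeny_by_ge0.
have b0 x i : 0 <= progeny_by mu B n x i by exact: progeny_by_ge0.
have z W x : progeny_by mu W n x 0 = 0 by case: (n).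
pose J (W : T * T -> R) x m :=
  convs (fun _ : unit => fun i => Kop mu W (progeny_by mu W n ^~ i) x) (nseq m tt) k.
have HJ m : multiplier mu A B (fun x => J A x m) (fun x => J B x m).
  by apply: multiplier_convs => _ i; exact: (multiplier_Kop bA bB (IH i)).
have HS : multiplier mu A B
    (fun x => \sum_(m < k.+1) (m`!%:R^-1)%:E * J A x m)
    (fun x => \sum_(m < k.+1) (m`!%:R^-1)%:E * J B x m).
  apply: (multiplier_sum bA bB) => m; apply: (multiplierM _ (HJ m)).
  by apply: (multiplier_cst bA bB); rewrite invr_ge0.
apply: (eq_multiplier _ _ (multiplierM (multiplier_exp_total_intensity bA bB) HS)).
- by move=> x; rewrite [RHS](poisson_expectation_convs mu x k mA A0 ma a0 (z A)).
- by move=> x; rewrite [RHS](poisson_expectation_convs mu x k mB B0 mb b0 (z B)).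
Qed.

Lemma same_progeny_prob k : progeny_prob mu A k = progeny_prob mu B k.
Proof.
have [mA A0] := (bk_measurable bA, bk_ge0 bA).
have [mB B0] := (bk_measurable bB, bk_ge0 bB).
apply/congr_lim/funext => n.
have ma m i : measurable_fun setT (progeny_by mu A m ^~ i).
  by have [[]] := multiplier_progeny_by m i.
have mb m i : measurable_fun setT (progeny_by mu B m ^~ i).
  by have [_ []] := multiplier_progeny_by m i.
under eq_integral do rewrite generations_expectation_convs// convs1.
under [in RHS]eq_integral do rewrite generations_expectation_convs// convs1.
exact: (multiplier_integral bA same_tau (multiplier_progeny_by n k)).
Qed.

Lemma same_Upsilon : Upsilon mu A = Upsilon mu B.
Proof. by apply: eq_eseriesr => k _; rewrite same_progeny_prob. Qed.

End same_progeny.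

(** * Homomorphism densities of rooted trees *)

Lemma emeasurable_prod d (T : measurableType d) (R : realType) (I : Type)
    (s : seq I) (h : I -> T -> \bar R) :
  (forall i, measurable_fun setT (h i)) ->
  measurable_fun setT (fun x => (\prod_(i <- s) h i x)%E).
Proof.
move=> mh; elim: s => [|i s IH].
  by under eq_fun do rewrite big_nil; exact: measurable_cst.
under eq_fun do rewrite big_cons.
exact: emeasurable_funM.
Qed.

Lemma measurable_nth_tuple d (T : measurableType d) (x0 : T) n i :
  measurable_fun [set: n.-tuple T] (fun y : n.-tuple T => nth x0 y i).
Proof.
have [ni|i_n] := leqP n i.
  rewrite (_ : (fun _ => _) = cst x0); first exact: measurable_cst.
  by apply/funext => y; rewrite nth_default ?size_tuple.
rewrite (_ : (fun _ => _) = (fun y : n.-tuple T => tnth y (Ordinal i_n))).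
  exact: measurable_tnth.
by apply/funext => y; rewrite (tnth_nth x0).
Qed.

Lemma probability_inhabited d (T : measurableType d) (R : realType)
  (mu : probability T R) : inhabited T.
Proof.
apply: contrapT => T0; have := probability_setT mu.
rewrite (_ : setT = set0) ?measure0 => [/eqP|]; first by rewrite eqe eq_sym oner_eq0.
by rewrite -subset0 => x _; apply: T0.
Qed.

(** The vertices of t are numbered so that parents come after their children and
    the root comes last; entry i of the code says that the parent of vertex i is
    vertex i.+1 + nth 0 (code t) i.  Because positions are relative, the code of a
    subtree does not change when the subtree is grafted.  In [Graft t1 t2] the
    vertices of t2 come first, followed by those of t1, and the root of t2 has to
    skip the size (code t1) non-root vertices of t1 to reach its parent. *)
Fixpoint code t : seq nat :=
  if t is Graft t1 t2 then code t2 ++ size (code t1) :: code t1 else [::].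

Section leaf_elimination.
Context d (T : measurableType d) (R : realType) (mu : probability T R).
Variables (W : T * T -> R) (C : R) (bW : bounded_kernel mu W C) (x0 : T).
Implicit Types (c : seq nat) (gs : seq (T -> \bar R)).

Let mW := bk_measurable bW.
Let W0 := bk_ge0 bW.

(** The integrand of the density of the tree coded by c, with an additional factor
    [nth (cst 1) gs i] for the type of vertex i. *)
Definition decorated c gs (s : seq T) : \bar R :=
  (\prod_(i < (size c).+1) nth (cst 1) gs i (nth x0 s i)) *
  (\prod_(i < size c) (W (nth x0 s i, nth x0 s (i.+1 + nth 0%N c i)))%:E).

Definition decorated_density c gs : \bar R :=
  \int[tuple_power mu (size c).+1]_y decorated c gs y.

Let nnms gs := forall i, nnm (nth (cst 1) gs i).

Lemma measurable_decorated c gs n : nnms gs ->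
  measurable_fun [set: n.-tuple T] (fun y : n.-tuple T => decorated c gs y).
Proof.
move=> ngs; apply: emeasurable_funM; apply: emeasurable_prod => i.
  by apply: measurableT_comp (measurable_nth_tuple x0 _); have [] := ngs i.
apply/measurable_EFinP; apply: measurableT_comp => //.
by apply: measurable_fun_pair; exact: measurable_nth_tuple.
Qed.

Lemma decorated_ge0 c gs s : nnms gs -> 0 <= decorated c gs s.
Proof.
move=> ngs; rewrite mule_ge0// prode_ge0// => i _; last by rewrite lee_fin.
by have [] := ngs i.
Qed.

Lemma prod_set_nth (n j : nat) gs g s : (j < n)%N ->
  \prod_(i < n) nth (cst 1) (set_nth (cst 1) gs j (nth (cst 1) gs j \* g)) i (nth x0 s i) =
  (\prod_(i < n) nth (cst 1) gs i (nth x0 s i)) * g (nth x0 s j).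
Proof.
move=> jn; rewrite (bigD1 (Ordinal jn))//= [in RHS](bigD1 (Ordinal jn))//=.
rewrite nth_set_nth/= eqxx -!muleA [g _ * _]muleC; congr (_ * (_ * _)).
apply: eq_bigr => i ij; rewrite nth_set_nth/=.
by rewrite -val_eqE/= in ij; rewrite (negbTE ij).
Qed.

(** Vertex 0 is a leaf, so its type occurs only in its decoration g and in the
    edge to its parent j; integrating it out multiplies the decoration of the
    parent by [Kop W g]. *)
Lemma leaf_elimination c j g gs : (j <= size c)%N -> nnm g -> nnms gs ->
  decorated_density (j :: c) (g :: gs) =
  decorated_density c (set_nth (cst 1) gs j (nth (cst 1) gs j \* Kop mu W g)).
Proof.
move=> jc ng ngs; have ngs' : nnms (g :: gs) by case.
rewrite /decorated_density [size _]/= integral_tuple_cons_swap; last 2 first.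
- exact: measurable_decorated.
- by move=> y; exact: decorated_ge0.
apply: eq_integral => y _; rewrite /decorated prod_set_nth//.
rewrite muleAC muleC /Kop -ge0_integralZr//; last 3 first.
- by apply: emeasurable_funM; [exact: measurable_section|case: ng].
- by move=> x _; rewrite mule_ge0 ?lee_fin//; case: ng.
- exact: decorated_ge0.
apply: eq_integral => x _.
rewrite [size _]/= big_ord_recl [X in _ * X]big_ord_recl /=.
rewrite (bk_sym bW) muleACA [g x * _]muleC; congr (_ * (_ * _)).
Qed.

(** Eliminating all the vertices of t but its root leaves [tau W t] there.  The
    root may already carry a decoration g, and further vertices may follow: both
    occur when t is a part of a larger tree. *)
Lemma decorated_density_code t c g gs : nnm g -> nnms gs ->
  decorated_density (code t ++ c) (nseq (size (code t)) (cst 1) ++ g :: gs) =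
  decorated_density c ((g \* tau mu W t) :: gs).
Proof.
have nseq_nnms n h hs : nnm h -> nnms hs -> nnms (nseq n (cst 1) ++ h :: hs).
  move=> nh nhs i; rewrite nth_cat; case: ifP => _; last by case: (i - _)%N.
  by rewrite nth_nseq; case: ifP => _; exact: nnm_cst.
have n1 : nnm (cst 1 : T -> \bar R) by exact: nnm_cst.
elim: t c g gs => [|t1 IH1 t2 IH2] c g gs ng ngs /=.
  by congr (decorated_density c (_ :: gs)); apply/funext => x /=; rewrite mule1.
have nt2 := nnm_tau bW t2.
rewrite -catA /= size_cat /= nseqD -catA /= IH2//; last exact: nseq_nnms.
have n2 : nnm (cst 1 \* tau mu W t2) by exact: nnmM.
rewrite leaf_elimination//; last 2 first.
- by rewrite size_cat leq_addr.
- exact: nseq_nnms.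
have -> : set_nth (cst 1) (nseq (size (code t1)) (cst 1) ++ g :: gs) (size (code t1))
    (nth (cst 1) (nseq (size (code t1)) (cst 1) ++ g :: gs) (size (code t1)) \*
     Kop mu W (cst 1 \* tau mu W t2)) =
    nseq (size (code t1)) (cst 1) ++ (g \* Kop mu W (cst 1 \* tau mu W t2)) :: gs.
  by elim: (size (code t1)) => //= n ->.
rewrite IH1//; last by apply: nnmM => //; exact: nnm_Kop bW _ _.
congr (decorated_density c (_ :: gs)); apply/funext => x /=.
rewrite -muleA [_ * tau mu W t1 x]muleC; congr (_ * (_ * Kop mu W _ x)).
by apply/funext => y /=; rewrite mul1e.
Qed.

Lemma tree_density_code t :
  \int[tuple_power mu (size (code t)).+1]_y
    (\prod_(i < size (code t))
       W (nth x0 y i, nth x0 y (i.+1 + nth 0%N (code t) i)))%:E =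
  \int[mu]_x tau mu W t x.
Proof.
have n1 : nnm (cst 1 : T -> \bar R) by exact: nnm_cst.
have nnil : nnms [::] by move=> i; rewrite nth_nil.
have [mt t0] := nnm_tau bW t.
have := decorated_density_code t [::] n1 nnil; rewrite cats0 => E.
transitivity (decorated_density [::] [:: cst 1 \* tau mu W t]); last first.
  rewrite /decorated_density /= integral_tuple_cons; last 2 first.
  - by apply: measurable_decorated => -[|i] //=; exact: nnmM.
  - by move=> y; apply: decorated_ge0 => -[|i] //=; exact: nnmM.
  apply: eq_integral => x _; rewrite (eq_integral (cst (tau mu W t x))) => [|y _].
    exact: integral_cst_probability.
  by rewrite /decorated big_ord1 big_ord0 /= mul1e mule1.
rewrite -E; apply: eq_integral => y _; rewrite /decorated [X in _ = X * _]big1 ?mul1e ?prodEFin//.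
move=> i _; rewrite nth_cat size_nseq nth_nseq; case: ifP => [_|_]; first by case: ifP.
by case: (i - size (code t))%N => [|[|k]].
Qed.

End leaf_elimination.

Section coded_graph.
Variable c : seq nat.

(** The root, vertex size c, has no parent: the prescribed number exceeds all
    vertices. *)
Definition coded_graph : rel 'I_(size c).+1 := fun u v =>
  (v == u.+1 + nth 0 c u :> nat)%N || (u == v.+1 + nth 0 c v :> nat)%N.

Lemma coded_graph_sym : symmetric coded_graph.
Proof. by move=> u v; rewrite /coded_graph orbC. Qed.

Lemma coded_graph_irr : irreflexive coded_graph.
Proof. by move=> u; rewrite /coded_graph orbb; apply/negbTE; lia. Qed.

Lemma coded_graph_lt (u v : 'I_(size c).+1) : (u < v)%N ->
  coded_graph u v = (v == u.+1 + nth 0 c u :> nat)%N.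
Proof. by move=> uv; rewrite /coded_graph orbC; case: eqP => //=; lia. Qed.

(** The least vertex of a cycle has two distinct neighbours in it, both larger,
    but its only larger neighbour is its parent. *)
Lemma coded_graph_acyclic : acyclic coded_graph.
Proof.
move=> s; case: s => [//|a s] s3 cs.
(* m is the least vertex, y and w its two neighbours along the cycle *)
have [m ms mmin] := @arg_minnP _ a [pred u in a :: s] val (mem_head _ _).
have [i p rp] := rot_to ms.
have : ucycle coded_graph (m :: p) by rewrite -rp /ucycle rot_cycle rot_uniq.
have : (2 < size (m :: p))%N by rewrite -rp size_rot.
have mle v : v \in m :: p -> (m <= v)%N by rewrite -rp mem_rot => /mmin.
case: p => [|y [|z q]] // in rp mle *.
move=> _ /andP[/= /and3P[my yz]]; rewrite rcons_path => /andP[_ lm].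
set w := last z q in lm => /and3P[].
rewrite !inE !negb_or => /and3P[/eqP mNy mNz mNq] /andP[/eqP yNz yNq] _.
have wzq : w \in z :: q by rewrite mem_last.
have yw : y <> w by move=> yw; move: wzq; rewrite -yw inE (negbTE yNq) orbF => /eqP.
have mw : m <> w.
  by move=> mw; move: wzq; rewrite -mw inE (negbTE mNz) (negbTE mNq).
have lt v : v \in m :: y :: z :: q -> m <> v -> (m < v)%N.
  by move=> /mle + mv; rewrite leq_eqVlt => /predU1P[/val_inj|].
have my' : (m < y)%N by apply: lt => //; rewrite !inE eqxx orbT.
have mw' : (m < w)%N by apply: lt => //; rewrite inE; apply/orP; right; rewrite inE wzq orbT.
move: my lm; rewrite [coded_graph w m]coded_graph_sym !coded_graph_lt// => /eqP h1 /eqP h2.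
by apply: yw; apply: ord_inj; rewrite h1 h2.
Qed.

Hypothesis c_ok : forall i, (i < size c)%N -> (i + nth 0 c i < size c)%N.

Lemma coded_graph_connect u : connect coded_graph u ord_max.
Proof.
have [n] := ubnP (size c - u); elim: n u => // n IH u un.
have [uc|cu] := ltnP u (size c); last first.
  by rewrite (_ : u = ord_max) ?connect0//; apply: val_inj => /=; have := ltn_ord u; lia.
have pu : (u.+1 + nth 0 c u < (size c).+1)%N by rewrite addSn ltnS; exact: c_ok.
apply: (@connect_trans _ _ (Ordinal pu)).
  by apply: connect1; rewrite /coded_graph /= eqxx.
by apply: IH => /=; lia.
Qed.

Lemma coded_graph_is_tree : is_tree coded_graph.
Proof.
split; first by split; [exact: coded_graph_sym|exact: coded_graph_irr].
- by rewrite card_ord.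
- move=> u v; apply: (connect_trans (coded_graph_connect u)).
  by rewrite (sym_connect_sym coded_graph_sym) coded_graph_connect.
- exact: coded_graph_acyclic.
Qed.

Lemma prod_edges (R : comPzRingType) (f : nat -> nat -> R) :
  (\prod_(p in edges coded_graph) f p.1 p.2 =
   \prod_(i < size c) f i (i.+1 + nth 0%N c i)%N)%R.
Proof.
transitivity (\prod_(u : 'I_(size c).+1)
    \prod_(v : 'I_(size c).+1 | (v == u.+1 + nth 0 c u :> nat)%N) f u v)%R.
  rewrite pair_big_dep/=; apply: eq_bigl => -[u v] /=.
  rewrite inE /= !enum_rank_ord /=.
  have [uv|vu] := ltnP u v; first by rewrite andbT coded_graph_lt.
  by rewrite andbF; apply/esym/negbTE; lia.
rewrite big_ord_recr /= [X in (_ * X)%R]big_pred0 ?mulr1 => [|v]; last first.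
  by apply/negbTE; have := ltn_ord v; lia.
apply: eq_bigr => i _.
have pi : (i.+1 + nth 0 c i < (size c).+1)%N by rewrite addSn ltnS c_ok.
by rewrite (big_pred1 (Ordinal pi)).
Qed.

End coded_graph.

Lemma code_ok t i : (i < size (code t))%N -> (i + nth 0 (code t) i < size (code t))%N.
Proof.
elim: t i => [|t1 IH1 t2 IH2] i //=.
rewrite size_cat /= nth_cat; have [i2 _|i2] := ltnP i (size (code t2)).
  by have := IH2 i i2; lia.
case E : (i - size (code t2))%N => [|k] /= ik; first by lia.
have kt1 : (k < size (code t1))%N by lia.
by have := IH1 k kt1; lia.
Qed.

Lemma hom_density_code d (T : measurableType d) (R : realType)
    (mu : probability T R) (W : T * T -> R) (C : R) t : bounded_kernel mu W C ->
  hom_density mu (coded_graph (c := code t)) W = \int[mu]_x tau mu W t x.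
Proof.
move=> bW; have [x0] := probability_inhabited mu.
rewrite -(tree_density_code bW x0) /hom_density.
set c := code t.
transitivity (\int[tuple_power mu #|'I_(size c).+1|]_y
    (\prod_(i < size c) W (nth x0 y i, nth x0 y (i.+1 + nth 0%N c i)))%:E).
  apply: eq_integral => y _; congr EFin.
  rewrite -(prod_edges (@code_ok t) (fun i j => W (nth x0 y i, nth x0 y j))).
  apply: eq_bigr => p _.
  by rewrite !(tnth_nth x0) !enum_rank_ord.
by rewrite card_ord.
Qed.

(** * Scaling *)

Section lebesgue_scaling.
Context (R : realType).
Implicit Types (a : R) (F : R -> \bar R).
Local Notation leb := (@lebesgue_measure R).

Import HBNNSimple.
Local Notation rT := (measurableTypeR R).

Definition scale a : rT -> rT := fun x => (a * x)%R.

Lemma measurable_scale a : measurable_fun [set: rT] (scale a).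
Proof. exact: (@measurable_funM _ _ _ setT (cst a) id). Qed.

(** The image of the Lebesgue measure under multiplication by a; as a term, the
    measure structure depends on a proof that [scale a] is measurable. *)
Definition lebesgue_scale a : {measure set rT -> \bar R}.
Proof. unshelve refine (pushforward leb (scale a)); exact: measurable_scale. Defined.

Lemma lebesgue_measure_scale a (a0 : (0 < a)%R) (A : set rT) : measurable A ->
  leb A = mscale (NngNum (ltW a0)) (lebesgue_scale a) A.
Proof.
apply: (@lebesgue_measure_unique R (mscale (NngNum (ltW a0)) (lebesgue_scale a))).
move=> _ [[x y] _ <-] /=.
rewrite /mscale /= /pushforward /=.
have -> : scale a @^-1` `]x, y] = `](x / a)%R, (y / a)%R]%classic.
  apply/seteqP; split => z /=; rewrite /scale !in_itv /=;
  by rewrite ltr_pdivrMr// ler_pdivlMr// [(a * _)%R]mulrC.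
rewrite !lebesgue_measure_itv /= !lte_fin ltr_pM2r ?invr_gt0//.
case: ifP => _; last by rewrite mule0.
by rewrite -!EFinB -EFinM -mulrBl mulrCA mulfV ?gt_eqF// mulr1.
Qed.

(** The integral of a nonnegative function is the supremum of the integrals of the
    simple functions below it, so it is monotone for all functions. *)
Lemma ge0_le_integral_nomeas (h F : R -> \bar R) :
  (forall x, 0 <= h x) -> (forall x, h x <= F x) ->
  \int[leb]_x h x <= \int[leb]_x F x.
Proof.
move=> h0 hF; have F0 x : 0 <= F x by exact: le_trans (h0 x) (hF x).
rewrite !ge0_integralTE//; apply: le_ereal_sup => _ [g gh <-].
by exists g => // x; exact: le_trans (gh x) (hF x).
Qed.

Lemma ge0_integral_scale a (h : rT -> \bar R) : (0 < a)%R ->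
  measurable_fun [set: rT] h -> (forall x, 0 <= h x) ->
  \int[leb]_x h x = a%:E * \int[leb]_x h (a * x)%R.
Proof.
move=> a0 mh h0.
rewrite -(ge0_integral_pushforward (@measurable_scale a) leb measurableT mh)//.
rewrite -(@ge0_integral_mscale _ _ R (lebesgue_scale a) setT measurableT (NngNum (ltW a0)))//.
apply: eq_measure_integral => A mA _; exact: lebesgue_measure_scale.
Qed.

(** Every simple function below F (a x) is the rescaling of one below F. *)
Let ge0_integral_scale_le a F : (0 < a)%R -> (forall x, 0 <= F x) ->
  a%:E * \int[leb]_x F (a * x)%R <= \int[leb]_x F x.
Proof.
move=> a0 F0; rewrite ge0_integralTE//.
rewrite -ereal_supZl ?(ltW a0)//; last first.
  apply/set0P; exists 0; exists (cst_nnsfun _ (0%:nng)%R) => /=; last by rewrite sintegral0.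
  by move=> x.
apply: ge_ereal_sup => _ [_ [g gF <-] <-].
have -> : sintegral leb g = \int[leb]_x (g x)%:E by rewrite integral_nnsfun// patch_setT.
have mg : measurable_fun [set: rT] (fun x : rT => (g (a^-1 * x)%R)%:E).
  by apply/measurable_EFinP; exact: (measurableT_comp (measurable_funP g) (@measurable_scale a^-1)).
have g0 x : 0 <= (g (a^-1 * x)%R)%:E by rewrite lee_fin.
have := ge0_integral_scale a0 mg g0.
under [in RHS]eq_integral => x _ do rewrite mulKf ?gt_eqF//.
move=> <-; apply: ge0_le_integral_nomeas => // x.
by apply: le_trans (gF _) _; rewrite mulVKf ?gt_eqF.
Qed.

Lemma ge0_integral_scale_nomeas a F : (0 < a)%R -> (forall x, 0 <= F x) ->
  \int[leb]_x F (a * x)%R = a^-1%:E * \int[leb]_x F x.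
Proof.
move=> a0 F0; have ai0 : (0 < a^-1)%R by rewrite invr_gt0.
apply/eqP; rewrite eq_le; apply/andP; split.
  by rewrite lee_pdivlMl// ge0_integral_scale_le.
(* the reverse inequality is the same one for x |-> F (a x) and a^-1 *)
have := ge0_integral_scale_le ai0 (fun x => F0 (a * x)%R).
by under eq_integral => x _ do rewrite mulVKf ?gt_eqF//.
Qed.

Lemma integral_scale a F : (0 < a)%R ->
  \int[leb]_(x in `[0%R, +oo[) F (a * x)%R =
  a^-1%:E * \int[leb]_(x in `[0%R, +oo[) F x.
Proof.
move=> a0; rewrite integral_mkcond [in RHS]integral_mkcond.
set G := F \_ _.
have -> : (fun x => F (a * x)%R) \_ `[0%R, +oo[ = fun x => G (a * x)%R.
  apply/funext => x; rewrite /G !patchE.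
  by rewrite !mem_setE !in_itv /= !andbT pmulr_rge0.
rewrite integralE [in RHS]integralE.
have -> : (fun x => G (a * x)%R)^\+ = fun x => G^\+ (a * x)%R.
  by apply/funext => x; rewrite !funeposE.
have -> : (fun x => G (a * x)%R)^\- = fun x => G^\- (a * x)%R.
  by apply/funext => x; rewrite !funenegE.
rewrite !ge0_integral_scale_nomeas//.
have P0 : 0 <= \int[leb]_x G^\+ x by exact: integral_ge0.
have N0 : 0 <= \int[leb]_x G^\- x by exact: integral_ge0.
have ai0 : 0 < (a^-1)%:E by rewrite lte_fin invr_gt0.
move: P0 N0; case: (\int[leb]_x G^\+ x) => [p||]//; case: (\int[leb]_x G^\- x) => [n||]// _ _.
- by rewrite muleBr.
- by rewrite muleBr.
- by rewrite /= gt0_muley.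
- by rewrite /= gt0_muley// gt0_muleNy.
Qed.

End lebesgue_scaling.

Section kernels.
Context d (T : measurableType d) (R : realType) (mu : probability T R).
Implicit Types (W : T * T -> R).

Lemma kernel_ae_bounded W : is_kernel mu W -> exists C : R, (0 <= C)%R /\
  {ae mu \x mu, forall p, (W p <= C)%R}.
Proof.
move=> [/andP[mW fW] _ W0].
have muT : 0 < (mu \x mu)%E setT.
  by rewrite [X in 0 < X](probability_setT (product_probability mu mu)).
move: fW; rewrite inE /= /finite_norm unlock; case: ifPn => [_|/negP[]]; last exact: muT.
set S := ess_sup _ _ => Soo.
exists (fine (maxe S 0)); split; first by rewrite fine_ge0// le_max lexx orbT.
have Sf : maxe S 0 \is a fin_num.
  by rewrite ge0_fin_numE ?le_max ?lexx ?orbT// gt_max Soo ltry.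
have := ess_sup_ge (mu \x mu)%E (abse \o (EFin \o W)).
apply: filterS => p Wp; rewrite -lee_fin fineK// le_max; apply/orP; left.
by apply: le_trans Wp; rewrite /= lee_fin ler_norm.
Qed.

(** Almost all sections of a null set are null. *)
Lemma kernel_bounded W : is_kernel mu W -> exists C, bounded_kernel mu W C.
Proof.
move=> kW; have [C [C0 HC]] := kernel_ae_bounded kW.
case: kW => /andP[+ _] Wsym W0; rewrite inE /= => mW.
exists C; split=> // u [mu_ u0].
have [N [mN N0 subN]] := HC.
have N0' : \int[mu]_x `|(mu \o xsection N) x| = 0.
  rewrite -[RHS]N0; apply: eq_integral => x _; rewrite gee0_abs//.
have mxN : measurable_fun setT (mu \o xsection N) by exact: measurable_fun_xsection.
have [/(_ N0') H _] := ae_eq_integral_abs mu measurableT mxN.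
move: H; apply: filterS => x /(_ I) /= xN0.
rewrite -ge0_integralZl//; apply: ae_ge0_le_integral => //.
- by move=> y _; rewrite mule_ge0 ?lee_fin.
- by apply: emeasurable_funM => //; exact: measurable_section.
- by move=> y _; rewrite mule_ge0 ?lee_fin.
- exact: measurable_funeM.
exists (xsection N x); split => //; first exact: measurable_xsection.
move=> y /= nle; rewrite /xsection /= inE; apply: subN => /= Wxy; apply: nle => _.
by rewrite lee_wpmul2r// lee_fin.
Qed.

Lemma bounded_kernel_scale W C c : (0 <= c)%R -> bounded_kernel mu W C ->
  bounded_kernel mu (fun z => c * W z)%R (c * C).
Proof.
move=> c0 [mW W0 Wsym C0 HC]; split.
- exact: measurable_funM.
- by move=> x y; rewrite mulr_ge0.
- by move=> x y; rewrite Wsym.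
- by rewrite mulr_ge0.
move=> u nu; move: (HC u nu); apply: filterS => x Kx.
case: nu => mu_ u0.
rewrite /Kop; under eq_integral do rewrite EFinM -muleA.
rewrite ge0_integralZl//; last 2 first.
- by apply: emeasurable_funM => //; exact: measurable_section.
- by move=> y _; rewrite mule_ge0 ?lee_fin.
by rewrite EFinM -muleA lee_wpmul2l.
Qed.

Lemma hom_density_scale (V : finType) (e : rel V) W C c : (0 <= c)%R ->
  bounded_kernel mu W C ->
  hom_density mu e (fun z => c * W z)%R = (c ^+ #|edges e|)%:E * hom_density mu e W.
Proof.
move=> c0 bW; rewrite /hom_density.
under eq_integral do rewrite big_split /= prodr_const EFinM.
rewrite ge0_integralZl//; last 2 first.
- by move=> y _; rewrite lee_fin prodr_ge0// => p _; exact: bk_ge0 bW _ _.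
- by rewrite lee_fin exprn_ge0.
apply/measurable_EFinP; under eq_fun do rewrite -big_filter.
apply: measurable_prod => p _.
apply: measurableT_comp; first exact: bk_measurable bW.
by apply: measurable_fun_pair; exact: measurable_tnth.
Qed.

Lemma fractional_multiple_Upsilon (f c : R) U W : (0 < f)%R -> (0 <= c)%R ->
  is_kernel mu U -> is_kernel mu W -> fractional_multiple mu f U W ->
  Upsilon mu (fun z => c * U z)%R = Upsilon mu (fun z => f * c * W z)%R.
Proof.
move=> f0 c0 /kernel_bounded[CU bU] /kernel_bounded[CW bW] UW.
have fc0 : (0 <= f * c)%R by rewrite mulr_ge0// ltW.
have bA := bounded_kernel_scale c0 bU; have bB := bounded_kernel_scale fc0 bW.
apply: (same_Upsilon bA bB) => t.
rewrite -(hom_density_code t bA) -(hom_density_code t bB).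
rewrite (hom_density_scale _ c0 bU) (hom_density_scale _ fc0 bW) UW.
  by rewrite muleA -EFinM -exprMn [(c * f)%R]mulrC.
exact: coded_graph_is_tree (@code_ok t).
Qed.

End kernels.

Theorem fact12 (d : measure_display) (T : measurableType d) (R : realType)
    (mu : probability T R) (mu_atomless : atomless mu) (mu_separable : separable mu)
    (U W : T * T -> R) (kernelU : is_kernel mu U) (kernelW : is_kernel mu W)
    (f : R) (f_gt0 : (0 < f)%R) (UW : fractional_multiple mu f U W) :
  kappa mu U = (f^-1)%:E * kappa mu W.
Proof.
rewrite -(integral_scale (fun c => Upsilon mu (fun z => c * W z)%R) f_gt0).
apply: eq_integral => c; rewrite inE /= in_itv /= andbT => c0.
exact: fractional_multiple_Upsilon.
Qed.
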